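(* If $x^\star\in\mathcal X$ is an optimal interior-point allocation, then $\mathsf{OptiVal}(x^\star)=\mathsf{PessVal}(x^\star)=v_1^\star$.
   Context: Setting. $\mathcal S$ and $\mathcal A$ are finite nonempty sets (states, actions); $\mathcal T:\mathcal S\times\mathcal A\times\mathcal S\to[0,1]$ is a transition kernel ($\mathcal T(s,a,s')$ is the probability of moving from $s$ to $s'$ under action $a$); $r:\mathcal S\times\mathcal A\to\mathbb R$; $\gamma\in(0,1)$; $\rho$ is a probability distribution on $\mathcal S$ (initial distribution). A policy is $\pi:\mathcal S\times\mathcal A\to[0,1]$ with $\sum_a\pi(s,a)=1$ for all $s$. The occupancy measure induced by $\pi$ is $m^\pi(s,a)=\sum_{t\ge0}\gamma^t\,\mathbb P_\pi(s_t=s,a_t=a)$ with $s_0\sim\rho$. The set of occupancy measures is $\mathcal M=\{m\in\mathbb R^{\mathcal S\times\mathcal A}: m\ge0,\ \sum_a m(s,a)=\rho(s)+\gamma\sum_{s',a'}\mathcal T(s',a',s)m(s',a')\ \forall s\in\mathcal S\}$ (these are exactly the $m^\pi$). For $f\in\mathbb R^{\mathcal S\times\mathcal A}$, $\langle f,m\rangle=\sum_{s,a}f(s,a)m(s,a)$. $\mathcal S_d\subseteq\mathcal S$ is a nonempty set of states at which reward can be allocated; a reward allocation is $x\in\mathbb R^{\mathcal S_d}$; with budget $C\ge0$ the admissible allocations are $\mathcal X=\{x: x\ge0,\ \sum_{s\in\mathcal S_d}x(s)\le C\}$. The follower's modified reward is $r_2^x(s,a)=r(s,a)+x(s)$ if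 $s\in\mathcal S_d$ and $r_2^x(s,a)=r(s,a)$ otherwise. The leader's reward is $r_1(s,a)=1$ if $s\in\mathcal S_d$ and $0$ otherwise. Best responses: $\mathsf{BR}(x)=\arg\max_{m\in\mathcal M}\langle r_2^x,m\rangle$. The reward design problem is: maximize $\langle r_1,m\rangle$ over $x\in\mathcal X$, $m\in\mathcal M$ subject to $m\in\mathsf{BR}(x)$; its optimal value is $v_1^\star$; if $(x,m)$ is an optimal solution, $x$ is called an optimal allocation and $m$ an optimal occupancy measure. $\mathsf{OptiVal}(x)=\max_{m\in\mathsf{BR}(x)}\langle r_1,m\rangle$ and $\mathsf{PessVal}(x)=\min_{m\in\mathsf{BR}(x)}\langle r_1,m\rangle$. The allocation region of $m\in\mathcal M$ is $\mathcal P_m=\{x\in\mathbb R^{\mathcal S_d}: m\in\mathsf{BR}(x)\}$; it is an optimal allocation region if $m$ is an optimal occupancy measure. $x\in\mathcal X$ is an interior-point allocation of $\mathcal P_m$ if there is $c>0$ with $x+cv\in\mathcal P_m$ for all $v\in\mathbb R^{\mathcal S_d}$ with $\|v\|_1\le1$. An optimal interior-point allocation is an interior-point allocation of some optimal allocation region. *)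

(* Defs.v *)
From HB Require Import structures.
From mathcomp Require Import all_boot all_order all_algebra.
From mathcomp Require Import boolp classical_sets reals.
Set Implicit Arguments. Unset Strict Implicit. Unset Printing Implicit Defensive.
Import Order.TTheory GRing.Theory Num.Theory.
Local Open Scope classical_set_scope.
Local Open Scope ring_scope.

Section Extrema.
Variable R : realType.
Implicit Types (E : set R) (v : R).

Definition is_max E v := E v /\ forall w, E w -> w <= v.
Definition is_min E v := E v /\ forall w, E w -> v <= w.

(* These are attained extrema, not suprema or infima; the value is 0 when the
   extremum is not attained. *)
Definition maxval E : R := xget 0 (is_max E).
Definition minval E : R := xget 0 (is_min E).

Lemma maxval_eq E v : is_max E v -> maxval E = v.
Proof.
move=> vE; apply: xget_unique => // w wE.
by apply/le_anti/andP; split; [exact: (vE.2 _ wE.1) | exact: (wE.2 _ vE.1)].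
Qed.

Lemma minval_eq E v : is_min E v -> minval E = v.
Proof.
move=> vE; apply: xget_unique => // w wE.
by apply/le_anti/andP; split; [exact: (wE.2 _ vE.1) | exact: (vE.2 _ wE.1)].
Qed.

End Extrema.

Section RewardDesign.
Variables (R : realType) (S A : finType).

Definition is_distr (p : S -> R) :=
  (forall s, 0 <= p s) /\ \sum_s p s = 1.

Definition is_kernel (T : S -> A -> S -> R) :=
  forall s a, is_distr (T s a).

Definition inner (f m : S -> A -> R) : R := \sum_s \sum_a f s a * m s a.

Definition alloc (Sd : {set S}) := {s : S | s \in Sd} -> R.

Variables (T : S -> A -> S -> R) (gamma : R) (rho : S -> R).
Variables (r : S -> A -> R) (Sd : {set S}) (C : R).

Definition occupancy : set (S -> A -> R) :=
  [set m | (forall s a, 0 <= m s a) /\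
           forall s, \sum_a m s a =
             rho s + gamma * \sum_s' \sum_a' T s' a' s * m s' a'].

Definition admissible : set (alloc Sd) :=
  [set x | (forall u, 0 <= x u) /\ \sum_u x u <= C].

Definition r1 (s : S) (a : A) : R := if s \in Sd then 1 else 0.

Definition r2 (x : alloc Sd) (s : S) (a : A) : R :=
  if insub s is Some u then r s a + x u else r s a.

Definition BR (x : alloc Sd) : set (S -> A -> R) :=
  [set m | occupancy m /\
           forall m', occupancy m' -> inner (r2 x) m' <= inner (r2 x) m].

Definition OptiVal (x : alloc Sd) : R := maxval [set inner r1 m | m in BR x].
Definition PessVal (x : alloc Sd) : R := minval [set inner r1 m | m in BR x].

Definition feasible : set (alloc Sd * (S -> A -> R)) :=
  [set z | [/\ admissible z.1, occupancy z.2 & BR z.1 z.2]].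

Definition v1star : R := maxval [set inner r1 z.2 | z in feasible].

Definition optimal_solution (x : alloc Sd) (m : S -> A -> R) :=
  feasible (x, m) /\
  forall z, feasible z -> inner r1 z.2 <= inner r1 m.

Definition optimal_occupancy (m : S -> A -> R) :=
  exists x, optimal_solution x m.

Definition alloc_region (m : S -> A -> R) : set (alloc Sd) :=
  [set x | BR x m].

Definition interior_point (m : S -> A -> R) (x : alloc Sd) :=
  admissible x /\
  exists2 c : R, 0 < c &
    forall v : alloc Sd, \sum_u `|v u| <= 1 ->
      alloc_region m (fun u => x u + c * v u).

(* The optimal pair witnessing [optimal_occupancy m] may involve an allocation
   other than [x]. *)
Definition optimal_interior_point (x : alloc Sd) :=
  exists2 m, optimal_occupancy m & interior_point m x.

End RewardDesign.

(* Main.v *)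
Require Import Defs.
From mathcomp Require Import all_boot all_order all_algebra.
From mathcomp Require Import boolp classical_sets reals.
Set Implicit Arguments. Unset Strict Implicit. Unset Printing Implicit Defensive.
Import Order.TTheory GRing.Theory Num.Theory.
Local Open Scope ring_scope.

(* Adding a constant [k] to the allocation adds [k * r1] to the follower's
   reward. If [x] is interior to the region of [m], both signs of a small [k] are
   allowed, so a best response [m'] to [x], which ties with [m] at [k = 0], must
   satisfy [<r1, m'> = <r1, m>]. *)

Lemma inner_addZ (R : realType) (S A : finType) (f g m : S -> A -> R) (k : R) :
  inner (fun s a => f s a + k * g s a) m = inner f m + k * inner g m.
Proof.
rewrite /inner mulr_sumr -big_split; apply: eq_bigr => s _ /=.
rewrite mulr_sumr -big_split; apply: eq_bigr => a _ /=.
by rewrite mulrDl mulrA.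
Qed.

Lemma inner_r2_shift (R : realType) (S A : finType) (r m : S -> A -> R)
    (Sd : {set S}) (x : alloc R Sd) (k : R) :
  inner (r2 r (fun u => x u + k)) m = inner (r2 r x) m + k * inner (r1 R Sd) m.
Proof.
rewrite -inner_addZ; apply: eq_bigr => s _; apply: eq_bigr => a _.
rewrite /r2 /r1; congr (_ * _).
by case: insubP => [u -> _|/negbTE ->]; rewrite ?mulr1 ?addrA // mulr0 addr0.
Qed.

Section InteriorPoint.
Variables (R : realType) (S A : finType).
Variables (T : S -> A -> S -> R) (r : S -> A -> R) (gamma : R) (rho : S -> R).
Variables (Sd : {set S}) (C : R) (m : S -> A -> R) (x : alloc R Sd).
Hypothesis mx : interior_point T gamma rho r C m x.

(** The zero direction is among those allowed by interiority, so [x] itself lies in the region of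
    [m]. *)
Lemma interior_point_BR : BR T gamma rho r x m.
Proof.
have [_ [c _ mc]] := mx; have := mc (fun=> 0).
rewrite big1 => [|u _]; last exact: normr0.
rewrite /alloc_region /= (_ : (fun u => _) = x); first exact.
by apply/funext => u; rewrite mulr0 addr0.
Qed.

Lemma interior_point_inner_r1 (m' : S -> A -> R) : Sd != finset.set0 ->
  BR T gamma rho r x m' -> inner (r1 R Sd) m' = inner (r1 R Sd) m.
Proof.
move=> Sd0 [om' m'max]; have [om _] := interior_point_BR.
have [_ [c c0 mc]] := mx.
have n0 : 0 < #|Sd|%:R :> R by rewrite ltr0n card_gt0.
(* For [e] equal to 1 or -1, the constant direction [e / #|Sd|] has l1 norm exactly 1, so a step of
   length [c] along it stays in the region of [m]. *)
have key (e : R) : `|e| = 1 ->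
    c * (e / #|Sd|%:R) * (inner (r1 R Sd) m' - inner (r1 R Sd) m) <= 0.
  move=> e1; have [|_ /(_ _ om')] := mc (fun=> e / #|Sd|%:R).
    rewrite sumr_const card_sig normrM e1 mul1r normfV gtr0_norm //.
    by rewrite -[_ *+ _]mulr_natl mulfV ?gt_eqF.
  (* Optimality of [m] at the shifted allocation is chained with optimality of [m'] at [x]; the
     [r2 r x] terms cancel and only the [r1] terms remain. *)
  rewrite !inner_r2_shift mulrBr subr_le0 => le_shift.
  rewrite -(lerD2l (inner (r2 r x) m')); apply: le_trans le_shift _.
  by rewrite lerD2r m'max.
have cn0 : 0 < c * (1 / #|Sd|%:R) by rewrite mulr_gt0 ?divr_gt0.
(* The sign [e = 1] bounds the value of [m'] above by that of [m]; [e = -1] gives the reverse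
   bound. *)
apply/le_anti; rewrite -subr_le0 -(pmulr_rle0 _ cn0) key ?normr1 //=.
have := key (-1); rewrite normrN1 mulNr mulrN mulNr oppr_le0 pmulr_rge0 //.
by rewrite subr_ge0; apply.
Qed.

End InteriorPoint.

Theorem proposition6 (R : realType) (S A : finType)
    (T : S -> A -> S -> R) (r : S -> A -> R) (gamma : R) (rho : S -> R)
    (Sd : {set S}) (C : R)
    (hS : (0 < #|S|)%N) (hA : (0 < #|A|)%N)
    (hT : is_kernel T) (hgamma : 0 < gamma < 1) (hrho : is_distr rho)
    (hSd : Sd != finset.set0) (hC : 0 <= C)
    (x : alloc R Sd) (hxX : admissible C x)
    (hx : optimal_interior_point T gamma rho r C x) :
  OptiVal T gamma rho r x = PessVal T gamma rho r x /\
  PessVal T gamma rho r x = v1star T gamma rho r Sd C.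
Proof.
have [m [x0 [x0m m_opt]] mx] := hx.
have mBR := interior_point_BR mx.
have BR_r1 m' := interior_point_inner_r1 (m' := m') mx hSd.
(* The leader's values over [BR x] form a singleton, so both extrema are attained at [m] and the
   default 0 never arises. *)
have -> : OptiVal T gamma rho r x = inner (r1 R Sd) m.
  by apply: maxval_eq; split=> [|_ [m' /BR_r1 -> <-]//]; exists m.
have -> : PessVal T gamma rho r x = inner (r1 R Sd) m.
  by apply: minval_eq; split=> [|_ [m' /BR_r1 -> <-]//]; exists m.
(* The maximum is attained at [(x0, m)]; [x0] may differ from [x], but the leader's value depends on
   [m] alone. *)
have -> // : v1star T gamma rho r Sd C = inner (r1 R Sd) m.
by apply: maxval_eq; split=> [|_ [z /m_opt z_le <-]//]; exists (x0, m).
Qed.
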